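(* Let $(R,\mathfrak m)$ be a Noetherian local ring and $\mathfrak p\in\operatorname{Spec}(R)$. Then $E_R(R/\mathfrak p)$ admits the structure of an $\hat{R}^{\mathfrak p}$-module, and $E_R(R/\mathfrak p)\cong E_{\hat{R}^{\mathfrak p}}(\hat{R}^{\mathfrak p}/\mathfrak p\hat{R}^{\mathfrak p})$ as $\hat{R}^{\mathfrak p}$-modules.
   Context: For a ring $A$ and an $A$-module $N$, $E_A(N)$ denotes an injective hull of $N$ over $A$. $\hat{R}^{\mathfrak p}$ denotes the $\mathfrak p$-adic completion of $R$, i.e. $\hat{R}^{\mathfrak p}=\varprojlim_s R/\mathfrak p^s$, regarded as an $R$-algebra via the natural map $R\to\hat{R}^{\mathfrak p}$. Saying that an $R$-module admits the structure of an $\hat{R}^{\mathfrak p}$-module means that its given $R$-module structure is the one induced from an $\hat{R}^{\mathfrak p}$-module structure via $R\to\hat{R}^{\mathfrak p}$. *)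

(* Defs.v *)
(* Commutative algebra in MathComp, with classical logic from MathComp-Analysis.
   Subsets are MathComp predicates {pred T}: since `[< P >] turns any
   proposition into a boolean, these are all the subsets of T. *)
From HB Require Import structures.
From mathcomp Require Import all_boot all_algebra.
From mathcomp Require Import boolp.

Set Implicit Arguments.
Unset Strict Implicit.
Unset Printing Implicit Defensive.

Import GRing.Theory.
Local Open Scope ring_scope.
Local Open Scope quotient_scope.

Section Rings.
Variable R : comNzRingType.

(* [submod_closed] over the regular module R^o: R itself is included among the
   ideals, in contrast with MathComp's [idealr], whose members are proper. *)
Definition noetherian : Prop :=
  forall I : {pred R^o}, submod_closed I ->
  exists n (g : 'I_n -> R),
    forall x, x \in I <-> exists c : 'I_n -> R, x = \sum_(i < n) c i * g i.

Definition maximal_ideal (m : idealr R) : Prop :=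
  forall I : idealr R, {subset m <= I} -> {subset I <= m}.

Definition local_ring (m : idealr R) : Prop :=
  maximal_ideal m /\ forall m' : idealr R, maximal_ideal m' -> m' =i m.

Definition ideal_mul (I J : {pred R}) : {pred R} :=
  [pred x | `[< exists n (a b : 'I_n -> R),
      [/\ forall i, a i \in I, forall i, b i \in J
        & x = \sum_(i < n) a i * b i] >]].

Fixpoint ideal_pow (I : {pred R}) (n : nat) : {pred R} :=
  if n is n'.+1 then ideal_mul I (ideal_pow I n') else predT.

End Rings.

Arguments ideal_pow : simpl never.

Section QuotientModule.
Variables (A : comNzRingType) (I : idealr A).

Definition quot_scale (a : A) (x : {ideal_quot I}) : {ideal_quot I} :=
  \pi_({ideal_quot I}) a * x.

Lemma quot_scaleA a b x : quot_scale a (quot_scale b x) = quot_scale (a * b) x.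
Proof. by rewrite /quot_scale mulrA rmorphM. Qed.

Lemma quot_scale1 : left_id 1 quot_scale.
Proof. by move=> x; rewrite /quot_scale rmorph1 mul1r. Qed.

Lemma quot_scaleDr : right_distributive quot_scale +%R.
Proof. by move=> a x y; rewrite /quot_scale mulrDr. Qed.

Lemma quot_scaleDl x : {morph quot_scale^~ x : a b / a + b}.
Proof. by move=> a b; rewrite /quot_scale rmorphD mulrDl. Qed.

HB.instance Definition _ := GRing.Zmodule_isLmodule.Build A {ideal_quot I}
  quot_scaleA quot_scale1 quot_scaleDr quot_scaleDl.

End QuotientModule.

Section IdealPower.
Variable R : comNzRingType.

Lemma ideal_mul_closed (I J : {pred R}) :
  (forall a, {in J, forall u, a * u \in J}) ->
  0 \in ideal_mul I J /\
  forall a, {in ideal_mul I J &, forall u v, a * u + v \in ideal_mul I J}.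
Proof.
move=> JM; split.
  apply/asboolP; exists 0, (fun=> 0), (fun=> 0).
  by split=> [[]|[]|]; rewrite ?big_ord0.
move=> a u v /asboolP[n1 [a1 [b1 [aI1 bJ1 ->]]]].
move=> /asboolP[n2 [a2 [b2 [aI2 bJ2 ->]]]]; apply/asboolP.
exists (n1 + n2)%N,
  (fun i => match split i with inl j => a1 j | inr j => a2 j end),
  (fun i => match split i with inl j => a * b1 j | inr j => b2 j end).
split=> [i|i|]; first by case: (split i).
  by case: (split i) => // j; apply: JM.
rewrite big_split_ord mulr_sumr /=; congr (_ + _); apply: eq_bigr => i _.
  by rewrite (unsplitK (inl i)) mulrCA.
by rewrite (unsplitK (inr i)).
Qed.

Lemma ideal_powS_sub (I : idealr R) n : {subset ideal_pow I n.+1 <= I}.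
Proof.
move=> _ /asboolP[k [a [b [aI _ ->]]]]; apply: rpred_sum => i _.
by rewrite mulrC idealMr.
Qed.

Lemma ideal_powM (I : {pred R}) n a :
  {in ideal_pow I n, forall u, a * u \in ideal_pow I n}.
Proof.
elim: n a => [|n IHn] a u uI //.
have [I0 IM] := ideal_mul_closed I IHn.
by rewrite -[a * u]addr0; apply: IM.
Qed.

Lemma ideal_powS_closed (I : idealr R) n : idealr_closed (ideal_pow I n.+1).
Proof.
have [I0 IM] := ideal_mul_closed I (@ideal_powM I n).
by split=> //; apply/negP => /ideal_powS_sub; rewrite idealr1.
Qed.

Definition ideal_powS (I : idealr R) n : idealr R :=
  HB.pack_for (idealr R) (ideal_pow I n.+1 : R -> bool)
    (isIdealr.Build R (ideal_pow I n.+1) (ideal_powS_closed I n)).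

Lemma ideal_powSS_sub (I : idealr R) n :
  {subset ideal_powS I n.+1 <= ideal_powS I n}.
Proof.
move=> _ /asboolP[k [a [b [_ bI ->]]]]; apply: rpred_sum => i _.
exact: (@ideal_powM I n.+1 (a i) (b i)).
Qed.

End IdealPower.

Section Completion.
Variables (R : comNzRingType) (I : idealr R).

(* R / I^n.+1; the zero ring R / I^0 is left out of the inverse system. *)
Local Notation Q n := {ideal_quot ideal_powS I n}.

(* Independent of the representative [repr x]: see [transition_pi]. *)
Definition transition n (x : Q n.+1) : Q n := \pi_(Q n) (repr x).

Lemma transition_pi n a : transition (\pi_(Q n.+1) a) = \pi_(Q n) a.
Proof.
apply/eqP; rewrite /transition -Quotient.idealrBE.
by apply: ideal_powSS_sub; rewrite Quotient.idealrBE reprK.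
Qed.

Lemma transition_is_zmod_morphism n : zmod_morphism (@transition n).
Proof.
move=> x y; rewrite -[x]reprK -[y]reprK -rmorphB !transition_pi.
by rewrite rmorphB.
Qed.

Lemma transition_is_monoid_morphism n : monoid_morphism (@transition n).
Proof.
split=> [|x y]; first by rewrite -(rmorph1 (\pi_(Q n.+1))) transition_pi rmorph1.
by rewrite -[x]reprK -[y]reprK -rmorphM !transition_pi rmorphM.
Qed.

HB.instance Definition _ n :=
  GRing.isZmodMorphism.Build (Q n.+1) (Q n) (@transition n)
    (@transition_is_zmod_morphism n).
HB.instance Definition _ n :=
  GRing.isMonoidMorphism.Build (Q n.+1) (Q n) (@transition n)
    (@transition_is_monoid_morphism n).

Definition completion : Type :=
  {x : forall n, Q n | `[< forall n, transition (x n.+1) = x n >]}.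

HB.instance Definition _ := SubChoice.on completion.

Definition completion_pi n (x : completion) : Q n := val x n.

Lemma completionP (x : completion) n : transition (completion_pi n.+1 x) = completion_pi n x.
Proof. by move: n; apply/asboolP; exact: (valP x). Qed.

Lemma completion_inj (x y : completion) :
  (forall n, completion_pi n x = completion_pi n y) -> x = y.
Proof. by move=> xy; apply/val_inj/functional_extensionality_dep/xy. Qed.

Definition completion_zero : completion.
Proof. by exists (fun=> 0); apply/asboolP => n; rewrite rmorph0. Defined.

Definition completion_one : completion.
Proof. by exists (fun=> 1); apply/asboolP => n; rewrite rmorph1. Defined.

Definition completion_opp (x : completion) : completion.
Proof.
by exists (fun n => - completion_pi n x); apply/asboolP => n; rewrite rmorphN /= completionP.
Defined.

Definition completion_add (x y : completion) : completion.
Proof.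
exists (fun n => completion_pi n x + completion_pi n y).
by apply/asboolP => n; rewrite rmorphD /= !completionP.
Defined.

Definition completion_mul (x y : completion) : completion.
Proof.
exists (fun n => completion_pi n x * completion_pi n y).
by apply/asboolP => n; rewrite rmorphM /= !completionP.
Defined.

Lemma completion_addA : associative completion_add.
Proof. by move=> x y z; apply: completion_inj => n; rewrite /completion_pi /= addrA. Qed.
Lemma completion_addC : commutative completion_add.
Proof. by move=> x y; apply: completion_inj => n; rewrite /completion_pi /= addrC. Qed.
Lemma completion_add0 : left_id completion_zero completion_add.
Proof. by move=> x; apply: completion_inj => n; rewrite /completion_pi /= add0r. Qed.
Lemma completion_addN : left_inverse completion_zero completion_opp completion_add.
Proof. by move=> x; apply: completion_inj => n; rewrite /completion_pi /= addNr. Qed.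

HB.instance Definition _ := GRing.isZmodule.Build completion
  completion_addA completion_addC completion_add0 completion_addN.

Lemma completion_mulA : associative completion_mul.
Proof. by move=> x y z; apply: completion_inj => n; rewrite /completion_pi /= mulrA. Qed.
Lemma completion_mulC : commutative completion_mul.
Proof. by move=> x y; apply: completion_inj => n; rewrite /completion_pi /= mulrC. Qed.
Lemma completion_mul1 : left_id completion_one completion_mul.
Proof. by move=> x; apply: completion_inj => n; rewrite /completion_pi /= mul1r. Qed.
Lemma completion_mulDl : left_distributive completion_mul +%R.
Proof. by move=> x y z; apply: completion_inj => n; rewrite /completion_pi /= mulrDl. Qed.
Lemma completion_one_neq0 : completion_one != 0.
Proof.
apply/eqP => /(congr1 (completion_pi 0%N)) /= /eqP.
by rewrite oner_eq0.
Qed.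

HB.instance Definition _ := GRing.Zmodule_isComNzRing.Build completion
  completion_mulA completion_mulC completion_mul1 completion_mulDl
  completion_one_neq0.

Definition to_completion (a : R) : completion.
Proof.
by exists (fun n => \pi_(Q n) a); apply/asboolP => n; rewrite transition_pi.
Defined.

Lemma to_completion_is_zmod_morphism : zmod_morphism to_completion.
Proof. by move=> a b; apply: completion_inj => n; rewrite /completion_pi /= rmorphB. Qed.

Lemma to_completion_is_monoid_morphism : monoid_morphism to_completion.
Proof.
by split=> [|a b]; apply: completion_inj => n; rewrite /completion_pi /= ?rmorph1 ?rmorphM.
Qed.

HB.instance Definition _ :=
  GRing.isZmodMorphism.Build R completion to_completion
    to_completion_is_zmod_morphism.
HB.instance Definition _ :=
  GRing.isMonoidMorphism.Build R completion to_completion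
    to_completion_is_monoid_morphism.

(* The ideal of the completion generated by the image of I. *)
Definition extension : {pred completion} :=
  [pred y | `[< exists n (b : 'I_n -> completion) (a : 'I_n -> R),
      (forall i, a i \in I) /\ y = \sum_(i < n) b i * to_completion (a i) >]].

Lemma completion_pi_sum n (x : 'I_n -> completion) k :
  completion_pi k (\sum_(i < n) x i) = \sum_(i < n) completion_pi k (x i).
Proof. by apply: (big_morph (completion_pi k)). Qed.

Lemma extension_closed : idealr_closed extension.
Proof.
split.
- by apply/asboolP; exists 0, (fun=> 0), (fun=> 0); split=> [[]|] //; rewrite big_ord0.
- apply/negP => /asboolP[n [b [a [aI /(congr1 (completion_pi 0%N))]]]].
  rewrite completion_pi_sum big1 => [/eqP|i _]; first by rewrite oner_eq0.
  rewrite [LHS](_ : _ = completion_pi 0 (b i) * \pi_(Q 0) (a i)) //.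
  suff -> : \pi_(Q 0) (a i) = 0 by rewrite mulr0.
  apply/eqP; rewrite -(rmorph0 (\pi_(Q 0))) -Quotient.idealrBE subr0.
  apply/asboolP; exists 1%N, (fun=> a i), (fun=> 1).
  by split=> //; rewrite big_ord1 mulr1.
- move=> c u v /asboolP[n1 [b1 [a1 [aI1 ->]]]] /asboolP[n2 [b2 [a2 [aI2 ->]]]].
  apply/asboolP; exists (n1 + n2)%N,
    (fun i => match split i with inl j => c * b1 j | inr j => b2 j end),
    (fun i => match split i with inl j => a1 j | inr j => a2 j end).
  split=> [i|]; first by case: (split i).
  rewrite big_split_ord mulr_sumr /=; congr (_ + _); apply: eq_bigr => i _.
    by rewrite (unsplitK (inl i)) mulrA.
  by rewrite (unsplitK (inr i)).
Qed.

Definition completion_ideal : idealr completion :=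
  HB.pack_for (idealr completion) (extension : completion -> bool)
    (isIdealr.Build completion extension extension_closed).

End Completion.

Section Modules.
Variable A : comNzRingType.

Definition injective_module (E : lmodType A) : Prop :=
  forall (M N : lmodType A) (i : {linear M -> N}) (f : {linear M -> E}),
    injective i -> exists g : {linear N -> E}, forall x, g (i x) = f x.

Definition essential_embedding (N E : lmodType A) (i : {linear N -> E}) : Prop :=
  injective i /\
  forall S : {pred E}, submod_closed S -> (exists2 x, x \in S & x != 0) ->
    exists2 y, i y \in S & i y != 0.

Definition injective_hull (N E : lmodType A) : Prop :=
  injective_module E /\ exists i : {linear N -> E}, essential_embedding i.

Definition isomorphic (M N : lmodType A) : Prop :=
  exists f : {linear M -> N}, bijective f.

End Modules.

Section ModuleStructure.
Variables (R A : comNzRingType) (h : {rmorphism R -> A}) (E : lmodType R).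

Definition module_structure : Type := GRing.Zmodule_isLmodule A E.

Definition lmod_of (s : module_structure) : Type := E.

HB.instance Definition _ (s : module_structure) := GRing.Zmodule.on (lmod_of s).
HB.instance Definition _ (s : module_structure) :=
  (s : GRing.Zmodule_isLmodule A (lmod_of s)).

Definition induces (s : module_structure) : Prop :=
  forall (a : R) (x : E), (h a *: (x : lmod_of s) : lmod_of s) = a *: x.

End ModuleStructure.

(* Main.v *)
From HB Require Import structures.
Require Import Defs.
From mathcomp Require Import all_boot all_algebra.
From mathcomp Require Import boolp ring.

Set Implicit Arguments.
Unset Strict Implicit.
Unset Printing Implicit Defensive.

Import GRing.Theory.
Local Open Scope ring_scope.
Local Open Scope quotient_scope.

(** Write A for the I-adic completion of R.  Every element of E = E_R(R/I) is
    killed by a power of I: if a lies in I, the ideals ann(a^n x) stabilise, so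
    for large n the submodule a^n R x has no nonzero a-torsion; were a^n x
    nonzero, essentiality would give this submodule a nonzero element of R/I,
    which a kills ([essential_ideal_nilpotent]).  Finitely many such a generate
    I, whence a power of I kills x ([nilpotent_words_kill]).  An element of A
    then acts on x through any of its residues modulo a high enough power of I
    ([completion_act]), and this is the structure on E.

    Let E' be an injective hull of A/IA over A.  As A/IA = R/I, the module E is
    an essential extension of A/IA over A too, and injectivity of E' embeds E
    in E' over A.  Injectivity of E over R splits this embedding R-linearly.
    The complement C is an A-submodule, because every element of A acts on a
    given x in E' as some element of R does ([hull_scale_descent]); and C meets
    A/IA in 0, so C = 0 by essentiality ([hull_completion_isomorphic]).

    That descent comes from the nilpotence statement applied to E' over A, and
    so needs the ring A to be Noetherian ([completion_noetherian]).  This is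
    derived without power series rings or associated graded rings.  If a is an
    element of a ring in which all sums of the c_n a^n make sense and which is
    separated for the powers of a, a Noetherian subring S yields the subring
    S[[a]] of all sums of c_n a^n with c_n in S, and the leading coefficient
    argument of Hilbert, read from the lowest order up, shows that S[[a]] is
    Noetherian ([power_series_noetherian]).  Starting from the image of R and
    adjoining generators of I one at a time, this exhausts A
    ([noetherian_of_complete], [completion_split]). *)

(** * Noetherian subrings and convergent power series *)

Section RelativeNoetherian.
Variable A : comNzRingType.
Implicit Types (S K : A -> Prop) (a x y z : A).

Definition subring S :=
  [/\ S 1, forall x y, S x -> S y -> S (x - y)
    & forall x y, S x -> S y -> S (x * y)].

Definition submodule_over S K :=
  [/\ K 0, forall x y, K x -> K y -> K (x - y)
    & forall s x, S s -> K x -> K (s * x)].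

Definition span S n (g : 'I_n -> A) x :=
  exists c : 'I_n -> A, (forall i, S (c i)) /\ x = \sum_(i < n) c i * g i.

Definition finitely_generated S K :=
  exists n (g : 'I_n -> A),
    (forall i, K (g i)) /\ forall x, K x -> span S g x.

(** Relative to a subring rather than to a ring type, so that a tower of
    subrings of one ambient ring can be climbed by induction. *)
Definition noetherian_subring S :=
  subring S /\
  forall K, (forall x, K x -> S x) -> submodule_over S K ->
    finitely_generated S K.

(** The value [y n] is the sum of the series c_n + c_(n+1) a + c_(n+2) a^2 + ...;
    the recursion satisfied by all the tails replaces a notion of limit. *)
Definition power_sum_complete a :=
  (forall c : nat -> A, exists y : nat -> A, forall n, y n = c n + a * y n.+1) /\
  (forall y, (forall n, exists z, y = a ^+ n * z) -> y = 0).

(** S[[a]], the set of sums of series in [a] with coefficients in [S], as the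
    greatest set X contained in S + aX: unfolding the inclusion produces the
    coefficients one by one.  Closure properties are proved by exhibiting X. *)
Definition power_series S a y :=
  exists X : A -> Prop,
    (forall x, X x -> exists c z, [/\ S c, X z & x = c + a * z]) /\ X y.

Lemma submodule_overD S K x y : submodule_over S K -> K x -> K y -> K (x + y).
Proof.
case=> K0 KB _ Kx Ky; rewrite -[y]opprK; apply: (KB) => //.
by rewrite -sub0r; apply: (KB).
Qed.

Lemma submodule_over_sum S K n (c g : 'I_n -> A) :
  submodule_over S K -> (forall i, S (c i)) -> (forall i, K (g i)) ->
  K (\sum_(i < n) c i * g i).
Proof.
move=> KS Sc Kg; elim/big_ind: _ => [|x y|i _]; first by case: KS.
  exact: submodule_overD KS.
by case: KS => _ _; apply.
Qed.

Lemma subring_submodule S : subring S -> submodule_over S S.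
Proof. by case=> S1 SB SM; split=> //; rewrite -(subrr 1); apply: SB. Qed.

Lemma span_cat S n1 (g1 : 'I_n1 -> A) n2 (g2 : 'I_n2 -> A) x y :
  span S g1 x -> span S g2 y ->
  span S (fun i => match split i with inl j => g1 j | inr j => g2 j end) (x + y).
Proof.
move=> [c1 [Sc1 ->]] [c2 [Sc2 ->]].
exists (fun i => match split i with inl j => c1 j | inr j => c2 j end).
split=> [i|]; first by case: (split i).
rewrite big_split_ord /=; congr (_ + _); apply: eq_bigr => i _.
  by rewrite (unsplitK (inl i)).
by rewrite (unsplitK (inr i)).
Qed.

Lemma complete_fixpoint0 a (d : nat -> A) :
  power_sum_complete a -> (forall n, d n = a * d n.+1) -> d 0%N = 0.
Proof.
case=> _ sep dE; apply: sep => n; exists (d n).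
by elim: n => [|n ->]; rewrite ?mul1r // dE exprSr mulrA.
Qed.

Section PowerSeries.
Variables (S : A -> Prop) (a : A).
Hypothesis subS : subring S.
Local Notation S' := (power_series S a).

Lemma power_seriesE y : S' y -> exists c z, [/\ S c, S' z & y = c + a * z].
Proof.
move=> [X [XE /[dup] Xy /XE[c [z [Sc Xz ->]]]]]; exists c, z.
by split=> //; exists X.
Qed.

Lemma subring0 : S 0.
Proof. by case: (subring_submodule subS). Qed.

Lemma power_series_coef c : S c -> S' c.
Proof.
move=> Sc; exists S; split=> // x Sx; exists x, 0.
by split=> //; [exact: subring0|rewrite mulr0 addr0].
Qed.

Lemma power_seriesB x y : S' x -> S' y -> S' (x - y).
Proof.
move=> Sx Sy; exists (fun w => exists u v, [/\ S' u, S' v & w = u - v]).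
split; last by exists x, y.
move=> _ [u [v [Su Sv ->]]]; have [c [u1 [Sc Su1 ->]]] := power_seriesE Su.
have [d [v1 [Sd Sv1 ->]]] := power_seriesE Sv.
exists (c - d), (u1 - v1); split; last by ring.
  by case: subS => _ + _; apply.
by exists u1, v1.
Qed.

Lemma power_seriesD x y : S' x -> S' y -> S' (x + y).
Proof.
move=> Sx Sy; rewrite -[y]opprK; apply: power_seriesB => //.
rewrite -sub0r; apply: power_seriesB => //.
exact/power_series_coef/subring0.
Qed.

Lemma power_seriesX y : S' y -> S' (a * y).
Proof.
move=> Sy; exists (fun w => exists2 u, S' u & w = u \/ w = a * u).
split; last by exists y => //; right.
move=> _ [u Su [->|->]]; last first.
  exists 0, u; rewrite add0r; split=> //; first exact: subring0.
  by exists u => //; left.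
have [c [z [Sc Sz ->]]] := power_seriesE Su.
by exists c, z; split=> //; exists z => //; left.
Qed.

Lemma power_seriesZ c y : S c -> S' y -> S' (c * y).
Proof.
move=> Sc Sy; exists (fun w => exists2 u, S' u & w = c * u).
split; last by exists y.
move=> _ [u /power_seriesE[d [z [Sd Sz ->]]] ->].
exists (c * d), (c * z); split; last by ring.
  by case: subS => _ _; apply.
by exists z.
Qed.

(** The tail of a product of two series is a series plus [a] times a product
    of two series, so the sums u + a v t form the set X. *)
Lemma power_seriesM x y : S' x -> S' y -> S' (x * y).
Proof.
move=> Sx Sy.
have [c [x1 [Sc Sx1 ->]]] := power_seriesE Sx.
rewrite mulrDl -mulrA; exists (fun w => exists u v t,
  [/\ S' u, S' v, S' t & w = u + a * (v * t)]); split; last first.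
  by exists (c * y), x1, y; split=> //; apply: power_seriesZ.
move=> _ [u [v [t [Su Sv St ->]]]].
have [d [u1 [Sd Su1 ->]]] := power_seriesE Su.
have [e [v1 [Se Sv1 ->]]] := power_seriesE Sv.
exists d, (u1 + (e + a * v1) * t); split=> //; last by ring.
exists (u1 + e * t), v1, t; split=> //; last by ring.
by apply: power_seriesD => //; apply: power_seriesZ.
Qed.

Lemma power_series_subring : subring S'.
Proof.
split; [|exact: power_seriesB|exact: power_seriesM].
by apply: power_series_coef; case: subS.
Qed.

Lemma power_series_var : S' a.
Proof.
case: power_series_subring => S'1 _ _.
by have := power_seriesX S'1; rewrite mulr1.
Qed.

Lemma power_series_sum (c y : nat -> A) :
  (forall n, S (c n)) -> (forall n, y n = c n + a * y n.+1) ->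
  forall n, S' (y n).
Proof.
move=> Sc yE n; exists (fun w => exists k, w = y k); split; last by exists n.
by move=> _ [k ->]; exists (c k), (y k.+1); split=> //; exists k.+1.
Qed.

Section Generation.
Variable K : A -> Prop.
Hypotheses (KS : submodule_over S' K) (subKS : forall x, K x -> S' x).
Hypothesis noethS : noetherian_subring S.
Hypothesis cpl : power_sum_complete a.

(** Coefficients in degree [d] of the series in [K] that have no lower terms. *)
Definition lowest_coef d c :=
  S c /\ exists2 z, S' z & K (a ^+ d * (c + a * z)).

Lemma lowest_coef_leq d e c : (d <= e)%N -> lowest_coef d c -> lowest_coef e c.
Proof.
move=> /subnK <-; elim: (e - d)%N => [//|k IHk] /IHk[Sc [z Sz Kz]].
split=> //; exists z => //; rewrite addSn exprS -mulrA.
case: KS => _ _; apply=> //.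
exact: power_series_var.
Qed.

Lemma lowest_coef_submodule d : submodule_over S (lowest_coef d).
Proof.
have [K0 KB KM] := KS; have [S1 SB SM] := subS.
split.
- split; first exact: subring0.
  by exists 0; [exact/power_series_coef/subring0|rewrite mulr0 addr0 mulr0].
- move=> x y [Sx [u Su Ku]] [Sy [v Sv Kv]]; split; first exact: SB.
  exists (u - v); first exact: power_seriesB.
  by rewrite (_ : _ * _ = a ^+ d * (x + a * u) - a ^+ d * (y + a * v));
    [exact: KB|ring].
- move=> s x Ss [Sx [u Su Ku]]; split; first exact: SM.
  exists (s * u); first exact: power_seriesZ.
  rewrite (_ : _ * _ = s * (a ^+ d * (x + a * u))); last by ring.
  by apply: KM => //; apply: power_series_coef.
Qed.

(** The [f i] lift generators of the ideal of lowest coefficients in degree [d].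
    Multiplied by a^e they cancel the lowest term of every series of order
    [d + e] whose lowest coefficient is in that ideal. *)
Lemma reduce_order d :
  exists n (f : 'I_n -> A), (forall i, K (f i)) /\
    forall e z c, lowest_coef d c -> S' z -> exists s : 'I_n -> A, (forall i, S (s i)) /\
      exists2 z', S' z' & a ^+ (d + e) * (c + a * z)
           - a ^+ e * \sum_(i < n) s i * f i = a ^+ (d + e).+1 * z'.
Proof.
have [c []//|n [g [Lg gL]]] := noethS.2 _ _ (lowest_coef_submodule d).
have /choice[w wP] : forall i, exists w, S' w /\ K (a ^+ d * (g i + a * w)).
  by move=> i; have [_ [w Sw Kw]] := Lg i; exists w.
exists n, (fun i => a ^+ d * (g i + a * w i)); split=> [i|]; first by case: (wP i).
move=> e z c Lc Sz; have [s [Ss ->]] := gL _ Lc.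
exists s; split=> //; exists (z - \sum_(i < n) s i * w i).
  apply: power_seriesB => //.
  apply: (submodule_over_sum (subring_submodule power_series_subring)) => i.
    exact: power_series_coef.
  by case: (wP i).
rewrite (_ : \sum_(i < n) s i * (_ * _) =
  a ^+ d * (\sum_(i < n) s i * g i + a * \sum_(i < n) s i * w i)); last first.
  rewrite mulrDr !mulr_sumr -big_split /=; apply: eq_bigr => i _; ring.
by rewrite exprS exprD; ring.
Qed.

(** Finitely many elements of [K] cancel all the terms of degree below [d]. *)
Lemma reduce_to_order d :
  exists n (g : 'I_n -> A), (forall i, K (g i)) /\
    forall x, K x -> exists y, [/\ span S g y, K (x - y)
      & exists2 z, S' z & x - y = a ^+ d * z].
Proof.
elim: d => [|d [n [g [Kg gP]]]].
  exists 0%N, (fun=> 0); split=> [[]//|x Kx]; exists 0; rewrite subr0.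
  split=> //; first by exists (fun=> 0); split=> [[]//|]; rewrite big_ord0.
  by exists x; [exact: subKS|rewrite mul1r].
have [n' [f [Kf fP]]] := reduce_order d.
exists (n + n')%N, (fun i => match split i with inl j => g j | inr j => f j end).
split=> [i|x /gP[y [gy Kxy [z Sz xyE]]]]; first by case: (split i).
have [c [z1 [Sc Sz1 zE]]] := power_seriesE Sz.
have cd : lowest_coef d c by split=> //; exists z1 => //; rewrite -zE -xyE.
have [s [Ss [z' Sz']]] := fP 0%N _ _ cd Sz1.
rewrite addn0 -zE -xyE mul1r => xysE.
exists (y + \sum_(i < n') s i * f i); rewrite opprD addrA; split.
- by apply: span_cat => //; exists s.
- case: (KS) => _ KB _; apply: KB => //; apply: submodule_over_sum KS _ _ => // i.
  exact: power_series_coef.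
- by exists z'.
Qed.

(** Multiplication by [a] makes the ideals of lowest coefficients increase with
    the degree, so the Noetherian property of [S] bounds this growth. *)
Lemma lowest_coef_stable :
  exists d, forall e c, lowest_coef e c -> lowest_coef d c.
Proof.
pose L c := exists d, lowest_coef d c.
have LS : submodule_over S L.
  split.
  - by exists 0%N; case: (lowest_coef_submodule 0).
  - move=> x y [d Lx] [e Ly]; exists (maxn d e).
    case: (lowest_coef_submodule (maxn d e)) => _ LB _; apply: LB.
      by apply: lowest_coef_leq Lx; rewrite leq_maxl.
    by apply: lowest_coef_leq Ly; rewrite leq_maxr.
  - move=> s x Ss [d Lx]; exists d.
    by case: (lowest_coef_submodule d) => _ _; apply.
have [c [d []]//|n [g [Lg gL]]] := noethS.2 L _ LS.
have /choice[d dP] : forall i, exists d, lowest_coef d (g i) by [].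
exists (\max_i d i)%N => e c ec.
have [|s [Ss ->]] := gL c; first by exists e.
apply: submodule_over_sum (lowest_coef_submodule _) Ss _ => i.
by apply: lowest_coef_leq (dP i); apply: leq_bigmax.
Qed.

(** Past the stable degree [d] the same lifts [f i] cancel the lowest term at
    every step; the multipliers used on [f i] at the successive steps are the
    coefficients of a series in [a], whose sum is the coordinate on [f i]. *)
Lemma power_series_generation : finitely_generated S' K.
Proof.
have [d dP] := lowest_coef_stable.
have [n [f [Kf fP]]] := reduce_order d.
have [n0 [g [Kg gP]]] := reduce_to_order d.
exists (n0 + n)%N, (fun i => match split i with inl j => g j | inr j => f j end).
split=> [i|x /gP[y [[s [Ss ->]] Kxy [z0 Sz0 xyE]]]]; first by case: (split i).
rewrite -[x](subrKC (\sum_(i < n0) s i * g i)).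
apply: span_cat; first by exists s; split=> // i; apply: power_series_coef.
move: (x - _) Kxy xyE => {s Ss}x Kx xE.
(* The remainder after e steps has order at least d + e. *)
pose F e y := K y /\ exists2 z, S' z & y = a ^+ (d + e) * z.
have /choice[sig sigP] : forall e, exists sig : A -> 'I_n -> A, forall y, F e y ->
    (forall i, S (sig y i)) /\ F e.+1 (y - a ^+ e * \sum_(i < n) sig y i * f i).
  move=> e; suff /choice[sig sigP] : forall w, exists s : 'I_n -> A, F e w ->
      (forall i, S (s i)) /\ F e.+1 (w - a ^+ e * \sum_(i < n) s i * f i).
    by exists sig.
  move=> w; have [Fw|nFw] := pselect (F e w); last first.
    by exists (fun=> 0) => /nFw.
  have [Kw [z Sz wE]] := Fw.
  have [c [z1 [Sc Sz1 zE]]] := power_seriesE Sz.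
  have ec : lowest_coef (d + e) c by split=> //; exists z1 => //; rewrite -zE -wE.
  have [s [Ss [z' Sz']]] := fP e _ _ (dP _ _ ec) Sz1.
  rewrite -zE -wE => wsE; exists s => _; split=> //; split; last first.
    by exists z' => //; rewrite addnS.
  case: (KS) => _ KB KM; apply: KB => //; apply: KM.
    elim: e {Fw wE ec wsE} => [|e IHe]; last by rewrite exprS; apply: power_seriesX.
    by apply: power_series_coef; case: subS.
  apply: submodule_over_sum KS _ _ => // i.
  exact: power_series_coef.
pose fix rem e : A := if e is k.+1 then
  rem k - a ^+ k * \sum_(i < n) sig k (rem k) i * f i else x.
have remF e : F e (rem e).
  elim: e => [|e /sigP[]//]; split=> //; by exists z0; rewrite ?addn0.
have /choice[Y YE] : forall i, exists Y : nat -> A,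
    forall e, Y e = sig e (rem e) i + a * Y e.+1.
  by move=> i; case: cpl => cplC _; apply: (cplC (fun e => sig e (rem e) i)).
exists (Y ^~ 0%N); split=> [i|].
  apply: (@power_series_sum (fun e => sig e (rem e) i)) => // e.
  by have [] := sigP _ _ (remF e).
apply/eqP; rewrite -subr_eq0; apply/eqP; case: (cpl) => _; apply=> e.
(* The error made by the full sums equals that made by their tails from e on,
   hence it is divisible by every power of a. *)
suff -> : x - \sum_(i < n) Y i 0%N * f i = rem e - a ^+ e * \sum_(i < n) Y i e * f i.
  have [_ [z _ ->]] := remF e.
  by exists (a ^+ d * z - \sum_(i < n) Y i e * f i); rewrite exprD; ring.
elim: e => [|e ->]; first by rewrite mul1r.
rewrite /= -addrA -opprD; congr (_ - _); rewrite exprSr -mulrA -mulrDr.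
congr (_ * _); rewrite mulr_sumr -big_split /=; apply: eq_bigr => i _.
by rewrite YE; ring.
Qed.

End Generation.

Lemma power_series_noetherian :
  noetherian_subring S -> power_sum_complete a -> noetherian_subring S'.
Proof.
move=> noethS cpl; split; first exact: power_series_subring.
by move=> K subKS KS; apply: power_series_generation.
Qed.

End PowerSeries.

Fixpoint ideal_span (bs : seq A) y :=
  if bs is b :: bs' then exists v w, ideal_span bs' w /\ y = b * v + w
  else y = 0.

(** A convergent series with terms in a finitely generated ideal has its sum in
    that ideal: sum the coordinates on the generators separately. *)
Lemma ideal_span_sum a bs (w : nat -> A) :
  power_sum_complete a -> (forall n, ideal_span bs (w n)) ->
  exists W : nat -> A,
    (forall n, ideal_span bs (W n)) /\ forall n, W n = w n + a * W n.+1.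
Proof.
move=> cpl; elim: bs w => [|b bs IHbs] w /= wP.
  by exists (fun=> 0); split=> // n; rewrite wP mulr0 addr0.
have /choice[v /choice[w' vP]] := wP.
have [W' [bsW' W'E]] := IHbs w' (fun n => (vP n).1).
have [V VE] := cpl.1 v.
exists (fun n => b * V n + W' n); split=> n; first by exists (V n), (W' n).
by rewrite VE W'E (vP n).2; ring.
Qed.

(** Adjoin the head [b] of [bs] to [S].  To see that S[[b]] and the remaining
    generators still fill the ring, expand y = c + b v + w, then v in the same
    way, and so on: the [c]s sum to an element of S[[b]], the [w]s to an element
    of the ideal spanned by the other generators. *)
Theorem noetherian_of_complete S (bs : seq A) :
  noetherian_subring S -> (forall b, b \in bs -> power_sum_complete b) ->
  (forall y, exists c w, [/\ S c, ideal_span bs w & y = c + w]) ->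
  noetherian_subring (fun=> True).
Proof.
elim: bs S => [|b bs IHbs] S noethS cpl Sbs.
  suff <- : S = fun=> True by [].
  apply/funext => y; apply/propext; split=> // _.
  by have [c [_ [Sc -> ->]]] := Sbs y; rewrite addr0.
have cplb : power_sum_complete b by apply: cpl; rewrite mem_head.
apply: IHbs (power_series_noetherian noethS.1 noethS cplb) _ _.
  by move=> b' bs_b'; apply: cpl; rewrite in_cons bs_b' orbT.
move=> y.
have /choice[c /choice[v /choice[w P]]] :
    forall y, exists c v w, [/\ S c, ideal_span bs w & y = c + b * v + w].
  move=> u; have [c [_ [Sc [v [w [bsw ->]]] ->]]] := Sbs u.
  by exists c, v, w; rewrite addrA.
pose u n := iter n v y.
have [C CE] := cplb.1 (fun n => c (u n)).
have [|W [bsW WE]] := @ideal_span_sum b bs (fun n => w (u n)) cplb.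
  by move=> n; case: (P (u n)).
exists (C 0%N), (W 0%N); split=> //.
  by apply: (power_series_sum _ CE) => n; case: (P (u n)).
apply/eqP; rewrite -subr_eq0; apply/eqP.
apply: (@complete_fixpoint0 b (fun n => u n - (C n + W n))) => // n.
have [_ _ ->] := P (u n).
by rewrite CE WE /u /=; ring.
Qed.

End RelativeNoetherian.

(** * The completion of a Noetherian ring is Noetherian *)

Lemma noetherianP (A : comNzRingType) :
  noetherian A <-> noetherian_subring (fun _ : A => True).
Proof.
split=> [noethA|[_ noethA] I [I0 IM]].
  split=> // K _ [K0 KB KM].
  have KbP x : (x \in [pred x | `[< K x >]]) <-> K x by split=> /asboolP.
  have [|n [g gP]] := noethA [pred x | `[< K x >]].
    split; first exact/KbP.
    move=> s x y /KbP Kx /KbP Ky; apply/KbP; rewrite -[y]opprK.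
    by apply: (KB); [exact: KM|rewrite -sub0r; apply: (KB)].
  exists n, g; split=> [i|x /KbP/gP[c ->]]; last by exists c.
  apply/KbP/gP; exists (fun j => (j == i)%:R).
  rewrite (bigD1 i) //= eqxx mul1r big1 ?addr0 // => j /negPf ->.
  by rewrite mul0r.
have IS : submodule_over (fun=> True) (fun x : A => x \in I).
  split=> // [x y Ix Iy|s x _ Ix]; last by rewrite -[s * x]addr0; apply: IM.
  by rewrite addrC -mulN1r; apply: IM.
have [//|n [g [Ig gI]]] := noethA _ _ IS.
exists n, g => x; split=> [/gI[c [_ ->]]|[c ->]]; first by exists c.
exact: (@submodule_over_sum _ _ _ _ c g IS).
Qed.

Lemma noetherian_image (R A : comNzRingType) (h : {rmorphism R -> A}) :
  noetherian R -> noetherian_subring (fun x => exists r, x = h r).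
Proof.
move=> /noetherianP[_ noethR]; split.
  split; first by exists 1; rewrite rmorph1.
    by move=> _ _ [r ->] [s ->]; exists (r - s); rewrite rmorphB.
  by move=> _ _ [r ->] [s ->]; exists (r * s); rewrite rmorphM.
move=> K subK [K0 KB KM].
have [//||n [g [Kg gK]]] := noethR (fun r => K (h r)).
  split; first by rewrite rmorph0.
    by move=> r s Kr Ks; rewrite rmorphB; apply: (KB).
  by move=> r s _ Ks; rewrite rmorphM; apply: (KM) => //; exists r.
exists n, (h \o g); split=> // x Kx; have [r xE] := subK _ Kx.
rewrite xE in Kx *; have [c [_ ->]] := gK _ Kx.
exists (h \o c); split=> [i|]; first by exists (c i).
by rewrite rmorph_sum; apply: eq_bigr => i _; rewrite rmorphM.
Qed.

Section CompletionNoetherian.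
Variables (R : comNzRingType) (I : idealr R).
Local Notation Q n := {ideal_quot ideal_powS I n}.

Lemma pi_eq0 (J : idealr R) a : (\pi_({ideal_quot J}) a = 0) <-> a \in J.
Proof.
rewrite -(rmorph0 (\pi_({ideal_quot J}))) -[a in a \in J]subr0.
by rewrite Quotient.idealrBE; split=> [->|/eqP].
Qed.

Lemma completion_piD n : {morph @completion_pi R I n : x y / x + y}.
Proof. by []. Qed.
Lemma completion_piM n : {morph @completion_pi R I n : x y / x * y}.
Proof. by []. Qed.
Lemma completion_pi_of n (a : R) :
  completion_pi n (to_completion I a) = \pi_(Q n) a.
Proof. by []. Qed.

Definition completion_of (x : forall n, Q n)
    (xP : forall n, transition (x n.+1) = x n) : completion I :=
  exist _ x (asboolT xP).

Lemma pi_expr_eq0 a n k : a \in I -> (n < k)%N -> \pi_(Q n) (a ^+ k) = 0.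
Proof.
move=> Ia nk; apply/pi_eq0; rewrite -(subnK nk) exprD; apply: ideal_powM => {nk}.
rewrite inE; elim: n => [|n IHn].
  by apply/asboolP; exists 1%N, (fun=> a), (fun=> 1); rewrite big_ord1 mulr1.
by apply/asboolP; exists 1%N, (fun=> a), (fun=> a ^+ n.+1); rewrite big_ord1 -exprS.
Qed.

(** Modulo I^(k+1) a series in [a] is the finite sum of its terms of degree at
    most [k]. *)
Lemma to_completion_complete a :
  a \in I -> power_sum_complete (to_completion I a).
Proof.
move=> Ia; split=> [c|y yP]; last first.
  apply: completion_inj => n; have [z ->] := yP n.+1.
  by rewrite completion_piM -rmorphXn /= completion_pi_of pi_expr_eq0 ?mul0r.
pose y n k : Q k :=
  \sum_(j < k.+1) completion_pi k (c (n + j)%N) * \pi_(Q k) (a ^+ j).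
have yP n k : transition (y n k.+1) = y n k.
  rewrite /y rmorph_sum /=; under eq_bigr do
    rewrite rmorphM /= completionP transition_pi.
  by rewrite big_ord_recr /= pi_expr_eq0 // mulr0 addr0.
exists (fun n => completion_of (yP n)) => n; apply: completion_inj => k.
rewrite completion_piD completion_piM completion_pi_of.
rewrite [LHS]/(y n k) [X in _ + _ * X]/(y n.+1 k) /y.
rewrite [LHS]big_ord_recl [in RHS]big_ord_recr /= expr0 rmorph1 mulr1 addn0.
congr (_ + _); rewrite mulrDr mulrCA -rmorphM -exprS /= pi_expr_eq0 // mulr0 addr0.
rewrite mulr_sumr; apply: eq_bigr => j _.
by rewrite mulrCA -rmorphM -exprS addSnnS.
Qed.

Definition generates n (a : 'I_n -> R) :=
  (forall i, a i \in I) /\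
  forall x, x \in I -> exists c, x = \sum_(i < n) c i * a i.

Lemma ideal_pow0 n : 0 \in ideal_pow I n.
Proof. by case: n => // n; apply: (rpred0 (ideal_powS I n)). Qed.

Lemma ideal_powD n : {in ideal_pow I n &, forall x y, x + y \in ideal_pow I n}.
Proof. by case: n => // n x y; apply: (rpredD (S := ideal_powS I n)). Qed.

Lemma ideal_powS_generated r (a : 'I_r -> R) n x :
  generates a -> x \in ideal_pow I n.+1 ->
  exists c : 'I_r -> R,
    (forall i, c i \in ideal_pow I n) /\ x = \sum_(i < r) c i * a i.
Proof.
move=> [_ aI] /asboolP[k [u [v [Iu Iv ->]]]].
have /choice[c uE] := fun j => aI _ (Iu j).
exists (fun i => \sum_(j < k) c j i * v j); split=> [i|].
  elim/big_ind: _ => [|x1 x2|j _]; [exact: ideal_pow0|exact: ideal_powD|].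
  exact: ideal_powM.
under eq_bigr do rewrite uE mulr_suml.
rewrite exchange_big /=; apply: eq_bigr => i _; rewrite mulr_suml.
by apply: eq_bigr => j _; rewrite mulrAC.
Qed.

(** Completing adds only multiples of the generators: A = R + IA.  Lift the
    components of [y] to elements u_n of R.  Then u_(n+1) - u_n lies in
    I^(n+1), so it is a combination of the [a i] with coefficients c_(n,i) in
    I^n, and for each [i] the sum over [n] of the c_(n,i) converges. *)
Lemma completion_split r (a : 'I_r -> R) y :
  generates a -> exists (c : R) (b : 'I_r -> completion I),
    y = to_completion I c + \sum_(i < r) b i * to_completion I (a i).
Proof.
move=> aI; pose u n := repr (completion_pi n y).
have uK n : \pi_(Q n) (u n) = completion_pi n y by rewrite /u reprK.
have /choice[c cP] : forall n, exists c : 'I_r -> R,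
    (forall i, c i \in ideal_pow I n) /\ u n.+1 - u n = \sum_(i < r) c i * a i.
  move=> n; apply: ideal_powS_generated => //.
  apply/(pi_eq0 (ideal_powS I n)); rewrite rmorphB /= uK.
  by rewrite -(transition_pi I n (u n.+1)) uK completionP subrr.
have c0 n i : \pi_(Q n) (c n.+1 i) = 0 by apply/pi_eq0; case: (cP n.+1).
(* As c k i lies in I^k, the terms with k > n vanish at level n. *)
pose b i n : Q n := \sum_(k < n.+1) \pi_(Q n) (c k i).
have bP i n : transition (b i n.+1) = b i n.
  rewrite /b rmorph_sum big_ord_recr /= transition_pi c0 addr0.
  by apply: eq_bigr => k _; rewrite transition_pi.
exists (u 0%N), (fun i => completion_of (bP i)); apply: completion_inj => n.
rewrite completion_piD completion_pi_sum completion_pi_of.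
under eq_bigr => i _.
  rewrite completion_piM completion_pi_of.
  rewrite [X in X * _]/(b i n) /b -rmorph_sum -rmorphM mulr_suml /=.
  over.
rewrite -rmorph_sum -rmorphD exchange_big /=.
under eq_bigr do rewrite -(cP _).2.
have -> : \sum_(i < n.+1) (u i.+1 - u i) = u n.+1 - u 0%N.
  by elim: (n.+1) => [|k IHk]; rewrite ?big_ord0 ?subrr // big_ord_recr IHk /=; ring.
by rewrite addrC subrK -transition_pi uK completionP.
Qed.

Lemma noetherian_generates :
  noetherian R -> exists r (a : 'I_r -> R), generates a.
Proof.
move=> /noetherianP[_ noethR].
have [//||r [a [Ia aI]]] := noethR (fun x => x \in I).
  split; [exact: rpred0|by move=> x y; apply: rpredB|].
  by move=> s x _; apply: idealMr.
exists r, a; split=> // x /aI[c [_ ->]]; by exists c.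
Qed.

Theorem completion_noetherian : noetherian R -> noetherian (completion I).
Proof.
move=> noethR; have [r [a aI]] := noetherian_generates noethR.
apply/noetherianP.
apply: (@noetherian_of_complete _ _ [seq to_completion I (a i) | i <- enum 'I_r]
  (noetherian_image (@to_completion R I) noethR)).
  by move=> _ /mapP[i _ ->]; apply: to_completion_complete; case: aI.
move=> y; have [c [b ->]] := completion_split y aI.
exists (to_completion I c), (\sum_(i < r) b i * to_completion I (a i)).
split=> //; first by exists c.
rewrite -[\sum_(i < r) _]big_enum /=.
elim: (enum 'I_r) => [|i s IHs]; first by rewrite big_nil.
by rewrite big_cons /= mulrC; do 2!eexists; split; first exact: IHs.
Qed.

End CompletionNoetherian.

(** * Torsion in essential extensions of R/I *)

Section EssentialTorsion.
Variables (A : comNzRingType) (J : idealr A) (E : lmodType A).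

Lemma quot_scaleE a b :
  a *: \pi_({ideal_quot J}) b = \pi_({ideal_quot J}) (a * b).
Proof. by rewrite rmorphM. Qed.

(** The ideal [K] is the union of the annihilators of the a^n x; it is finitely
    generated, so it is reached at some [n], and a^n A x has no a-torsion.  The
    image of A/J, all of which [a] kills, therefore meets a^n A x in 0. *)
Lemma essential_ideal_nilpotent (i : {linear {ideal_quot J} -> E}) (x : E) a :
  noetherian A -> essential_embedding i -> a \in J ->
  exists n, a ^+ n *: x = 0.
Proof.
move=> /noetherianP[_ noethA] [_ ess] Ja.
pose K b := exists n, (a ^+ n * b) *: x = 0.
have annS n m b : (n <= m)%N -> (a ^+ n * b) *: x = 0 -> (a ^+ m * b) *: x = 0.
  by move=> /subnK <- bx0; rewrite exprD -mulrA -scalerA bx0 scaler0.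
have [//||r [g [Kg gK]]] := noethA K.
  split; first by exists 0%N; rewrite mulr0 scale0r.
    move=> b c [n bx0] [m cx0]; exists (maxn n m).
    by rewrite mulrBr scalerBl (annS n) ?leq_maxl // (annS m) ?leq_maxr // subrr.
  by move=> c b _ [n bx0]; exists n; rewrite mulrCA -scalerA bx0 scaler0.
have /choice[d dP] := Kg.
pose n := (\max_i d i)%N; exists n.
have stable b m : (a ^+ m * b) *: x = 0 -> (a ^+ n * b) *: x = 0.
  move=> bx0; have [|c [_ ->]] := gK b; first by exists m.
  rewrite mulr_sumr scaler_suml big1 // => j _.
  by rewrite mulrCA -scalerA (annS (d j)) ?scaler0 // leq_bigmax.
have [//|anx] := eqVneq (a ^+ n *: x) 0.
have [||y /asboolP[b iyE] iy0] :=
    ess [pred z | `[< exists b, z = (a ^+ n * b) *: x >]].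
- split; first by apply/asboolP; exists 0; rewrite mulr0 scale0r.
  move=> c _ _ /asboolP[b1 ->] /asboolP[b2 ->]; apply/asboolP; exists (c * b1 + b2).
  by rewrite scalerA -scalerDl mulrDr mulrCA.
- by exists (a ^+ n *: x) => //; apply/asboolP; exists 1; rewrite mulr1.
case/eqP: iy0; rewrite iyE; apply: (stable _ n.+1).
rewrite exprS -mulrA -scalerA -iyE -linearZ -[y]reprK quot_scaleE.
by rewrite (pi_eq0 _ _).2 ?linear0 // mulrC idealMr.
Qed.

(** When [s] generates an ideal, this says that the [n]-th power of the ideal
    kills [x]; words allow an induction on the generators. *)
Fixpoint words_kill (s : seq A) n (x : E) : Prop :=
  if n is n'.+1 then forall a, a \in s -> words_kill s n' (a *: x) else x = 0.

Lemma words_killZ s n b x : words_kill s n x -> words_kill s n (b *: x).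
Proof.
elim: n x => [|n IHn] x /=; first by move=> ->; rewrite scaler0.
by move=> kx a sa; rewrite scalerA mulrC -scalerA; apply/IHn/kx.
Qed.

Lemma words_kill_leq s n m x :
  (n <= m)%N -> words_kill s n x -> words_kill s m x.
Proof.
move=> /subnK <-; elim: (m - n)%N => [//|k IHk] /IHk kx.
by rewrite addSn => a sa; apply: words_killZ.
Qed.

(** A word of length [n + m] either avoids [a], and then its first [m] letters
    kill [x], or it is [a] times a word of length at least [n]; for [m = 0] the
    second hypothesis is already [x = 0]. *)
Lemma words_kill_cons a s n m x :
  words_kill (a :: s) n (a *: x) -> words_kill s m x ->
  words_kill (a :: s) (n + m) x.
Proof.
elim: m x => [|m IHm] x kax.
  by move=> ->; rewrite -[0](scale0r x); apply: (@words_kill_leq _ 0); rewrite ?scale0r.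
rewrite addnS => kx b; rewrite in_cons => /predU1P[->|sb].
  exact: words_kill_leq (leq_addr _ _) kax.
apply: IHm; last exact: kx.
by rewrite scalerA mulrC -scalerA; apply: words_killZ.
Qed.

Lemma nilpotent_words_kill s :
  (forall a (x : E), a \in s -> exists n, a ^+ n *: x = 0) ->
  forall x : E, exists n, words_kill s n x.
Proof.
elim: s => [|a s IHs] nil x; first by exists 1%N.
have [m amx] := nil a x (mem_head a s).
elim: m x amx => [|m IHm] x; first by rewrite scale1r; exists 0%N.
rewrite exprSr -scalerA => /IHm[n1 kax].
have [|n2 kx] := IHs _ x; last by exists (n1 + n2)%N; apply: words_kill_cons.
by move=> b y sb; apply: nil; rewrite in_cons sb orbT.
Qed.

End EssentialTorsion.

(** * The module structure over the completion *)

Section CyclicMap.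
Variables (A : comNzRingType) (J : idealr A) (E : lmodType A) (e : E).
Hypothesis Je : forall b, b \in J -> b *: e = 0.

Definition quot_map (y : {ideal_quot J}) : E := repr y *: e.

Lemma quot_mapE b : quot_map (\pi_({ideal_quot J}) b) = b *: e.
Proof.
apply/eqP; rewrite /quot_map -subr_eq0 -scalerBl Je //.
by apply/pi_eq0; rewrite rmorphB /= reprK subrr.
Qed.

Lemma quot_map_linear : linear quot_map.
Proof.
move=> c x y; rewrite -[x]reprK -[y]reprK quot_scaleE -rmorphD !quot_mapE.
by rewrite scalerDl scalerA.
Qed.

End CyclicMap.

Definition linear_of (A : comNzRingType) (M N : lmodType A) (f : M -> N)
    (lf : linear f) : {linear M -> N} :=
  HB.pack f (GRing.isLinear.Build A M N *:%R f lf).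

Section CompletionAction.
Variables (R : comNzRingType) (I : idealr R) (E : lmodType R).
Local Notation Q n := {ideal_quot ideal_powS I n}.

Definition power_kills n (x : E) :=
  forall u, u \in ideal_pow I n -> u *: x = 0.

Hypothesis torsionE : forall x, exists n, power_kills n.+1 x.

Definition completion_act (b : completion I) (x : E) : E :=
  repr (completion_pi (projT1 (cid (torsionE x))) b) *: x.

Lemma completion_pi_leq n m (b : completion I) r : (n <= m)%N ->
  \pi_(Q m) r = completion_pi m b -> \pi_(Q n) r = completion_pi n b.
Proof.
move=> /subnK <-; elim: (m - n)%N => [//|k IHk] rE; apply: IHk.
by rewrite -transition_pi [X in transition X]rE completionP.
Qed.

Lemma power_kills_leq n m x :
  (n <= m)%N -> power_kills n.+1 x -> power_kills m.+1 x.
Proof.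
move=> /subnK <-; elim: (m - n)%N => [//|k IHk] /IHk kx u uI.
exact/kx/ideal_powSS_sub.
Qed.

Lemma power_killsZ n b x : power_kills n x -> power_kills n (b *: x).
Proof. by move=> kx u uI; rewrite scalerA mulrC -scalerA kx // scaler0. Qed.

(** The action does not depend on the level at which an element of the
    completion is approximated, provided the corresponding power of I kills
    [x]: two levels agree at the lower of the two. *)
Lemma completion_actE n b x r :
  power_kills n.+1 x -> \pi_(Q n) r = completion_pi n b ->
  completion_act b x = r *: x.
Proof.
rewrite /completion_act; case: cid => m /= kmx knx rE.
apply/eqP; rewrite -subr_eq0 -scalerBl.
have [k [km kx]] : exists k,
    \pi_(Q k) (repr (completion_pi m b) - r) = 0 /\ power_kills k.+1 x.
  have sE := reprK (completion_pi m b); case: (leqP n m) => [nm|/ltnW mn].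
    exists n; split=> //.
    by rewrite rmorphB /= rE (completion_pi_leq nm sE) subrr.
  exists m; split=> //.
  by rewrite rmorphB /= sE (completion_pi_leq mn rE) subrr.
by rewrite kx //; apply/(pi_eq0 (ideal_powS I k)).
Qed.

Lemma completion_act_repr n b x :
  power_kills n.+1 x -> completion_act b x = repr (completion_pi n b) *: x.
Proof. by move=> kx; apply: (completion_actE kx); rewrite reprK. Qed.

Lemma completion_actA a b x :
  completion_act a (completion_act b x) = completion_act (a * b) x.
Proof.
have [n kx] := torsionE x.
rewrite (completion_act_repr b kx) (completion_act_repr a (power_killsZ _ kx)).
rewrite scalerA; apply/esym/(completion_actE kx).
by rewrite rmorphM /= !reprK.
Qed.

Lemma completion_act_of r x : completion_act (to_completion I r) x = r *: x.
Proof. by have [n kx] := torsionE x; apply: (completion_actE kx). Qed.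

Lemma completion_act1 : left_id 1 completion_act.
Proof. by move=> x; rewrite -(rmorph1 (to_completion I)) completion_act_of scale1r. Qed.

Lemma completion_actDr : right_distributive completion_act +%R.
Proof.
move=> b x y; have [n kx] := torsionE x; have [m ky] := torsionE y.
have {}kx := power_kills_leq (leq_maxl n m) kx.
have {}ky := power_kills_leq (leq_maxr n m) ky.
rewrite !(completion_act_repr (n := maxn n m)) ?scalerDr //.
by move=> u uI; rewrite scalerDr kx // ky // addr0.
Qed.

Lemma completion_actDl x : {morph completion_act^~ x : a b / a + b}.
Proof.
move=> a b; have [n kx] := torsionE x.
rewrite (completion_act_repr a kx) (completion_act_repr b kx) -scalerDl.
by apply: (completion_actE kx); rewrite rmorphD /= !reprK.
Qed.

Definition completion_structure : module_structure (completion I) E :=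
  GRing.Zmodule_isLmodule.Build (completion I) E
    completion_actA completion_act1 completion_actDr completion_actDl.

Lemma completion_structure_induces :
  induces (@to_completion R I) completion_structure.
Proof. exact: completion_act_of. Qed.

End CompletionAction.

(** * Comparison of the two injective hulls *)

Section RestrictScalars.
Variables (R A : comNzRingType) (h : {rmorphism R -> A}) (E : lmodType A).

Definition restrict_scale (r : R) (x : E) : E := h r *: x.

Lemma restrict_scaleA a b x :
  restrict_scale a (restrict_scale b x) = restrict_scale (a * b) x.
Proof. by rewrite /restrict_scale scalerA rmorphM. Qed.
Lemma restrict_scale1 : left_id 1 restrict_scale.
Proof. by move=> x; rewrite /restrict_scale rmorph1 scale1r. Qed.
Lemma restrict_scaleDr : right_distributive restrict_scale +%R.
Proof. by move=> a x y; rewrite /restrict_scale scalerDr. Qed.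
Lemma restrict_scaleDl x : {morph restrict_scale^~ x : a b / a + b}.
Proof. by move=> a b; rewrite /restrict_scale rmorphD scalerDl. Qed.

Definition restrict_scalars : module_structure R E :=
  GRing.Zmodule_isLmodule.Build R E
    restrict_scaleA restrict_scale1 restrict_scaleDr restrict_scaleDl.

End RestrictScalars.

Section Hulls.
Variables (R : comNzRingType) (I : idealr R).
Hypothesis noethR : noetherian R.
Local Notation hat := (@to_completion R I).
Local Notation I' := (completion_ideal I).

Lemma to_completion_ideal a : a \in I -> hat a \in I'.
Proof.
move=> Ia; apply/asboolP; exists 1%N, (fun=> 1), (fun=> a).
by split=> //; rewrite big_ord1 mul1r.
Qed.

Lemma hull_power_kills (E : lmodType R) :
  injective_hull {ideal_quot I} E -> forall x : E, exists n, power_kills I n.+1 x.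
Proof.
move=> [_ [i essi]] x; have [r [a aI]] := noetherian_generates I noethR.
have [|n kx] := @nilpotent_words_kill _ E [seq a j | j <- enum 'I_r] _ x.
  move=> _ y /mapP[j _ ->].
  by apply: essential_ideal_nilpotent essi _ => //; case: aI.
exists n.
suff kill m (y : E) : words_kill [seq a j | j <- enum 'I_r] m y -> power_kills I m.+1 y.
  exact: kill.
elim: m y => [|m IHm] y; first by move=> -> u _; rewrite scaler0.
move=> ky u /(ideal_powS_generated aI)[c [cI ->]].
rewrite scaler_suml big1 // => j _; rewrite -scalerA.
by apply: IHm (cI j); apply/ky/map_f/mem_enum.
Qed.

(** The completion acts on [x] through R when all words of length [n] in the
    generators of I kill [x].  Writing b = c + sum of the d_j a_j, the elements
    a_j x are killed by shorter words, so d_j acts on them through R. *)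
Lemma hull_scale_descent (E : lmodType (completion I)) :
  injective_hull {ideal_quot I'} E ->
  forall (b : completion I) (x : E), exists r, b *: x = hat r *: x.
Proof.
move=> [_ [i essi]] b x; have [r [a aI]] := noetherian_generates I noethR.
have [|n kx] := @nilpotent_words_kill _ E [seq hat (a j) | j <- enum 'I_r] _ x.
  move=> _ y /mapP[j _ ->]; apply: essential_ideal_nilpotent essi _.
    exact: completion_noetherian.
  by apply: to_completion_ideal; case: aI.
elim: n x b kx => [|n IHn] x b; first by move=> ->; exists 0; rewrite !scaler0.
move=> kx; have [c [d ->]] := completion_split b aI.
have /choice[s sE] : forall j, exists s, d j *: (hat (a j) *: x) = hat s *: (hat (a j) *: x).
  by move=> j; apply/IHn/kx/map_f/mem_enum.
exists (c + \sum_(j < r) s j * a j).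
rewrite rmorphD rmorph_sum !scalerDl !scaler_suml; congr (_ + _).
by apply: eq_bigr => j _; rewrite rmorphM -!scalerA sE.
Qed.


(** The complement of the image of E in E' is a submodule over the completion
    that meets A/IA in 0, so it vanishes. *)
Theorem hull_completion_isomorphic (E : lmodType R) (E' : lmodType (completion I))
    (s : module_structure (completion I) E) :
  injective_hull {ideal_quot I} E -> induces hat s ->
  injective_hull {ideal_quot I'} E' -> isomorphic (lmod_of s) E'.
Proof.
move=> [injE [i [i_inj essi]]] sE hullE'.
have [injE' [i' [i'_inj essi']]] := hullE'.
have descend := hull_scale_descent hullE'.
pose e : lmod_of s := i (\pi_({ideal_quot I}) 1).
have eE r : hat r *: e = i (\pi_({ideal_quot I}) r).
  by rewrite (sE r e) -linearZ quot_scaleE mulr1.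
have [r [a aI]] := noetherian_generates I noethR.
have I'e b : b \in I' -> b *: e = 0.
  move=> /asboolP[n [c [d [Id ->]]]]; rewrite scaler_suml big1 // => k _.
  by rewrite -scalerA eE (pi_eq0 _ _).2 // linear0 scaler0.
pose j := linear_of (quot_map_linear I'e).
have jE b : j (\pi_({ideal_quot I'}) b) = b *: e by exact: quot_mapE.
have quot_hat (y : {ideal_quot I'}) : exists r, y = \pi_({ideal_quot I'}) (hat r).
  have [c [d yE]] := completion_split (repr y) aI; exists c.
  apply/eqP; rewrite -[y]reprK -subr_eq0 -rmorphB; apply/eqP/pi_eq0.
  rewrite yE addrC addKr; apply/asboolP; exists r, d, a.
  by split=> //; case: aI.
have j_inj : injective j.
  apply: raddf_inj => y; have [c ->] := quot_hat y; move/(etrans (esym (jE _))).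
  rewrite eE -(linear0 i) => /i_inj/pi_eq0 Ic.
  exact/pi_eq0/to_completion_ideal.
have ji c : j (\pi_({ideal_quot I'}) (hat c)) = i (\pi_({ideal_quot I}) c).
  by rewrite jE eE.
(* g embeds E in E' over the completion, extending the identity of A/IA; it is
   injective because E is essential over R/I = A/IA. *)
have [g gj] := injE' _ _ j i' j_inj.
have g_inj : injective g.
  apply: raddf_inj => x gx0; apply/eqP/contraT => x0.
  have [||y /asboolP giy0 /eqP[]] := essi [pred z : E | `[< g (z : lmod_of s) = 0 >]].
  - split; first by apply/asboolP; rewrite linear0.
    move=> c u v /asboolP gu /asboolP gv; apply/asboolP.
    by rewrite linearD -(sE c u) linearZ /= gu gv scaler0 addr0.
  - by exists x => //; apply/asboolP.
  move: giy0; rewrite -[y]reprK -ji gj -(linear0 i') => /i'_inj ->.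
  by rewrite linear0.
pose E'R : lmodType R := lmod_of (restrict_scalars hat E').
have gR_linear : linear (g : E -> E'R).
  move=> c u v; rewrite (linearD g); congr (_ + _).
  by rewrite -(sE c u) (linearZ_LR g).
(* h is an R-linear retraction of g; its kernel is the complement of E in E'. *)
have [h hg] := injE _ _ (linear_of gR_linear) idfun g_inj.
have {}hg x : h (g x) = x := hg x.
have h_inj x : h x = 0 -> x = 0.
  move=> hx0; apply/eqP/contraT => x0.
  have [||y /asboolP hiy0 /eqP[]] := essi' [pred z : E' | `[< h (z : E'R) = 0 >]].
  - split; first by apply/asboolP; rewrite linear0.
    move=> b u v /asboolP hu /asboolP hv; apply/asboolP.
    have [c ->] := descend b u.
    by rewrite (linearD h (hat c *: u)) (linearZ_LR h c u) hu hv scaler0 addr0.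
  - by exists x => //; apply/asboolP.
  move: hiy0; rewrite -gj hg -(linear0 j) => /j_inj ->.
  by rewrite (linear0 j) (linear0 g).
exists g; exists h => // x.
by apply/eqP; rewrite -subr_eq0; apply/eqP/h_inj; rewrite (linearB h) hg subrr.
Qed.

End Hulls.

Theorem theorem1p1 (R : comNzRingType) (m : idealr R)
    (noethR : noetherian R) (localR : local_ring m) (p : prime_idealr R)
    (E : lmodType R) (hullE : injective_hull {ideal_quot p} E) :
  exists s : module_structure (completion p) E,
    induces (@to_completion R p) s /\
    forall E' : lmodType (completion p),
      injective_hull {ideal_quot (completion_ideal p)} E' ->
      isomorphic (lmod_of s) E'.
Proof.
have sE := completion_structure_induces (hull_power_kills noethR hullE).
by eexists; split; [exact: sE|move=> E'; apply: hull_completion_isomorphic].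
Qed.
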